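(* Let $X$ be a Poisson-distributed random finite set on $\mathbb{X}$ with probability hypothesis density (intensity) $D:\mathbb{X}\to[0,\infty)$ and global cardinality mean $N_X=\int_{\mathbb{X}}D(\mathbf{x})\,\mathrm{d}\mathbf{x}<\infty$, i.e. with multi-object density $f(X)=e^{-N_X}\prod_{\mathbf{x}\in X}D(\mathbf{x})$. Let $\mathcal{S}\subseteq\mathbb{X}_s$ be a field-of-view. Then the number of objects inside $\mathcal{S}$ is distributed according to the probability mass function $$\rho_{\mathcal{S}}(n)=\sum_{m=n}^{\infty}\frac{e^{-N_X}}{n!\,(m-n)!}\,\langle 1_{\mathcal{S}},D\rangle^{n}\,\langle 1-1_{\mathcal{S}},D\rangle^{m-n},\qquad n=0,1,2,\dots$$
   Context: The single-object state space is $\mathbb{X}=\mathbb{X}_s\times\mathbb{X}_v\subseteq\mathbb{R}^{n_x}$, with $\mathbb{X}_s\subseteq\mathbb{R}^{n_s}$ (e.g. position space) and $\mathbb{X}_v$ the remaining state components. A field-of-view is a compact subset $\mathcal{S}$ of $\mathbb{X}_s$. For $\mathbf{x}\in\mathbb{X}$ with $\mathbb{X}_s$-component $\mathbf{s}$, the generalized indicator is $1_{\mathcal{S}}(\mathbf{x})=1$ if $\mathbf{s}\in\mathcal{S}$ and $0$ otherwise. For integrable functions, $\langle f,g\rangle=\int_{\mathbb{X}} f(\mathbf{x})g(\mathbf{x})\,\mathrm{d}\mathbf{x}$. All functions are measurable, and empty products equal $1$. A multi-object density is a function $f$ on finite subsets of $\mathbb{X}$, integrated by the set integral $$\int g(X)\,\delta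 X=\sum_{m=0}^{\infty}\frac{1}{m!}\int_{\mathbb{X}^m}g(\{\mathbf{x}_1,\dots,\mathbf{x}_m\})\,\mathrm{d}\mathbf{x}_1\cdots\mathrm{d}\mathbf{x}_m ,$$ the $m=0$ term being $g(\emptyset)$. The conditional probability that exactly $n$ objects lie inside the field-of-view given $X$ is $$\rho_{\mathcal{S}}(n\mid X)=\sum_{X^n\subseteq X,\ |X^n|=n}\ \prod_{\mathbf{x}\in X^n}1_{\mathcal{S}}(\mathbf{x})\prod_{\mathbf{x}\in X\setminus X^n}(1-1_{\mathcal{S}}(\mathbf{x})),$$ and the field-of-view cardinality distribution is $\rho_{\mathcal{S}}(n)=\int\rho_{\mathcal{S}}(n\mid X)\,f(X)\,\delta X$. *)

(* Defs.v *)
From HB Require Import structures.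
From mathcomp Require Import all_boot all_order all_algebra.
From mathcomp Require Import finmap.
From mathcomp Require Import all_classical all_reals all_analysis.
Set Implicit Arguments.
Unset Strict Implicit.
Unset Printing Implicit Defensive.
Import Order.TTheory GRing.Theory Num.Theory.
Import numFieldNormedType.Exports.
Local Open Scope classical_set_scope.
Local Open Scope ring_scope.

(* R^n with the n-fold product of the Borel
   sigma-algebra of R; [measurableTypeR R], convertible to R, is the measurable
   type on which [lebesgue_measure] is declared. *)
Notation euclidean R n := (n.-tuple (measurableTypeR R)).

(* R^(ns + nv), split as R^ns * R^nv *)
Notation state R ns nv := ((euclidean R ns * euclidean R nv)%type).

(* [mu \x nu] itself is canonically sigma-finite in the library only for
   subprobability factors, hence the alias. *)
Section prod_measure.
Context d1 d2 (T1 : measurableType d1) (T2 : measurableType d2).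
Context (R : realType).
Variable mu : {sigma_finite_measure set T1 -> \bar R}.
Variable nu : {sigma_finite_measure set T2 -> \bar R}.

Definition prod_measure : set (T1 * T2) -> \bar R := (mu \x nu)%E.

HB.instance Definition _ := Measure.on prod_measure.

Let prod_measure_sigma_finite : sigma_finite setT prod_measure.
Proof.
have /sigma_finiteP[F [TF ndF Foo]] := sigma_finiteT mu.
have /sigma_finiteP[G [TG ndG Goo]] := sigma_finiteT nu.
exists (fun n => F n `*` G n).
  rewrite -setXTT TF TG predeqE => -[x y]; split.
    move=> [/= [n _ Fnx] [k _ Gky]]; exists (maxn n k) => //; split.
    - by move: x Fnx; exact/subsetPset/ndF/leq_maxl.
    - by move: y Gky; exact/subsetPset/ndG/leq_maxr.
  by move=> [n _ []/= ? ?]; split; exists n.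
move=> k; have [? ?] := Foo k; have [? ?] := Goo k.
split; first exact: measurableX.
by rewrite /prod_measure product_measure1E// lte_mul_pinfty// ge0_fin_numE.
Qed.

HB.instance Definition _ := Measure_isSigmaFinite.Build _ _ _ prod_measure
  prod_measure_sigma_finite.

End prod_measure.

Section cons_measure.
Context d (T : measurableType d) (R : realType) (n : nat).
Variable mu : {sigma_finite_measure set T -> \bar R}.
Variable nu : {sigma_finite_measure set (n.-tuple T) -> \bar R}.

Definition cons_pair (p : T * n.-tuple T) : n.+1.-tuple T :=
  [the n.+1.-tuple T of p.1 :: p.2].

Definition uncons_pair (t : n.+1.-tuple T) : T * n.-tuple T :=
  (thead t, [tuple of behead t]).

Lemma cons_pairK : cancel cons_pair uncons_pair.
Proof.
move=> [x t]; rewrite /uncons_pair /cons_pair /= theadE.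
by congr (_, _); apply: val_inj.
Qed.

Lemma measurable_cons_pair : measurable_fun [set: T * n.-tuple T] cons_pair.
Proof. exact: measurable_cons. Qed.

Lemma measurable_uncons_pair :
  measurable_fun [set: n.+1.-tuple T] uncons_pair.
Proof.
apply/measurable_fun_pairP; split; first exact: measurable_tnth.
exact: measurable_behead.
Qed.

Definition cons_measure : set (n.+1.-tuple T) -> \bar R :=
  pushforward (prod_measure mu nu) cons_pair.

Let cons_measure0 : cons_measure set0 = 0%E.
Proof. by rewrite /cons_measure /pushforward preimage_set0 measure0. Qed.

Let cons_measure_ge0 A : (0 <= cons_measure A)%E.
Proof. by rewrite /cons_measure /pushforward measure_ge0. Qed.

Let cons_measure_sigma_additive : semi_sigma_additive cons_measure.
Proof.
have mcons A : measurable A -> measurable (cons_pair @^-1` A).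
  by move=> mA; rewrite -[X in measurable X]setTI; exact: measurable_cons_pair.
move=> F mF tF mUF; rewrite /cons_measure /pushforward preimage_bigcup.
apply: measure_semi_sigma_additive.
- by move=> k; exact: mcons.
- apply/trivIsetP => i j _ _ ij; rewrite -preimage_setI.
  by move/trivIsetP : tF => /(_ _ _ _ _ ij) ->//; rewrite preimage_set0.
- by rewrite -preimage_bigcup; exact: mcons.
Qed.

HB.instance Definition _ := isMeasure.Build _ _ _ cons_measure
  cons_measure0 cons_measure_ge0 cons_measure_sigma_additive.

Let cons_measure_sigma_finite : sigma_finite setT cons_measure.
Proof.
have [F TF Foo] := sigma_finiteT (prod_measure mu nu).
exists (fun k => uncons_pair @^-1` F k).
  by rewrite -preimage_bigcup -TF preimage_setT.
move=> k; have [mF Fk] := Foo k; split.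
  by rewrite -[X in measurable X]setTI; exact: measurable_uncons_pair.
rewrite /cons_measure /pushforward -comp_preimage.
by rewrite (_ : uncons_pair \o cons_pair = id)//; apply/funext/cons_pairK.
Qed.

HB.instance Definition _ := Measure_isSigmaFinite.Build _ _ _ cons_measure
  cons_measure_sigma_finite.

End cons_measure.

(* The n-fold product of mu: a unit mass at the empty tuple for n = 0, and the
   image of mu \x mu^n under (x, t) |-> x :: t for n.+1. *)
Fixpoint power_measure d (T : measurableType d) (R : realType)
    (mu : {sigma_finite_measure set T -> \bar R}) (n : nat) :
    {sigma_finite_measure set (n.-tuple T) -> \bar R} :=
  match n with
  | 0 => \d_([tuple] : 0.-tuple T)
  | n'.+1 => cons_measure mu (power_measure mu n')
  end.

Definition lebesgue_euclidean (R : realType) (n : nat) :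
    {sigma_finite_measure set (euclidean R n) -> \bar R} :=
  power_measure (@lebesgue_measure R) n.

(* n-tuples carry no topology in the library: compactness is that of the
   corresponding set of row vectors. *)
Definition euclidean_compact (R : realType) (n : nat)
    (A : set (euclidean R n)) :=
  compact [set (\row_i (tnth t i : R)) | t in A].

Section state_space.
Variables (R : realType) (ns nv : nat).

Local Notation state := (state R ns nv).

Definition state_measure : {sigma_finite_measure set state -> \bar R} :=
  prod_measure (lebesgue_euclidean R ns) (lebesgue_euclidean R nv).

Implicit Types (X : set state) (S : set (euclidean R ns)).
Local Open Scope fset_scope.

Definition inner X (f g : state -> R) : R :=
  \int[state_measure]_(x in X) (f x * g x).

Definition fov_indic S (x : state) : R := \1_S x.1.

Definition cartesian_power X (m : nat) : set (m.-tuple state) :=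
  [set t | forall i, X (tnth t i)].

Definition set_integral X (g : {fset state} -> R) : \bar R :=
  (\sum_(m <oo) (m`!%:R^-1)%:E *
     \int[power_measure state_measure m]_(t in @cartesian_power X m)
        (g [fset x in (t : seq state)])%:E)%E.

Definition fov_card_cond S (n : nat) (Y : {fset state}) : R :=
  \sum_(Z <- fpowerset Y | #|` Z| == n)
     (\prod_(x <- Z) fov_indic S x) *
     (\prod_(x <- Y `\` Z) (1 - fov_indic S x)).

Definition fov_card_dist X S (f : {fset state} -> R) (n : nat) : \bar R :=
  set_integral X (fun Y => fov_card_cond S n Y * f Y).

Definition card_mean X (D : state -> R) : R :=
  \int[state_measure]_(x in X) D x.

Definition poisson_density X (D : state -> R) (Y : {fset state}) : R :=
  expR (- card_mean X D) * \prod_(x <- Y) D x.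

End state_space.

Definition is_pmf (R : realType) (p : nat -> \bar R) :=
  (forall n, 0 <= p n)%E /\ (\sum_(n <oo) p n = 1)%E.

(* Main.v *)
(* Enumerating the points of a finite set Y by a repetition-free sequence s, the
   integrand of rho n at Y is exp(-N) times [count_weight A h n s], i.e. the
   product of the intensity h along s, restricted to sequences with exactly n
   entries in A = S x R^nv. Points are null (ns + nv > 0), so tuples with
   repetitions do not contribute, and splitting off the first entry x according
   to whether x lies in A gives, by Tonelli, Pascal's recurrence
     I(m+1, n) = a I(m, n-1) + b I(m, n)   with a = <1_S, D>, b = <1 - 1_S, D>.
   Hence the m-fold integral is 'C(m, n) a^n b^(m-n). *)
Require Import Defs.
From mathcomp Require Import all_boot all_order all_algebra.
From mathcomp Require Import finmap.
From mathcomp Require Import all_classical all_reals all_analysis.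
From mathcomp Require Import ring.
Set Implicit Arguments.
Unset Strict Implicit.
Unset Printing Implicit Defensive.
Import Order.TTheory GRing.Theory Num.Theory.
Import numFieldNormedType.Exports measurable_realfun.
Local Open Scope classical_set_scope.
Local Open Scope ring_scope.

(** A point is a section of the diagonal, and sections of measurable sets are measurable. In an
    abstract measurable space neither points nor the diagonal need be measurable, hence the
    hypothesis. *)
Lemma measurable_singleton d (T : measurableType d) (x : T) :
  measurable [set p : T * T | p.1 = p.2] -> measurable [set x].
Proof.
move=> mdiag; rewrite (_ : [set x] = pair x @^-1` [set p : T * T | p.1 = p.2]).
  rewrite -[X in measurable X]setTI; have := @pair1_measurable _ _ T T x.
  by apply.
by apply/seteqP; split => y /= ->.
Qed.

(** * Weighted counting of points and its integral over m-fold products *)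

Section count_weight.
Context d (T : measurableType d) (R : realType).
Variables (A : set T) (h : T -> R).

(** Defined on sequences rather than finite sets so that the first entry can be split off. It is
    later applied to [undup t], which enumerates the set of entries of a tuple [t]. *)
Definition count_weight (n : nat) (s : seq T) : R :=
  (count (fun x => x \in A) s == n)%:R * \prod_(x <- s) h x.

Lemma perm_count_weight n s t : perm_eq s t ->
  count_weight n s = count_weight n t.
Proof.
by move=> st; rewrite /count_weight (perm_big _ st) (permP st).
Qed.

Lemma count_weight_nil n : count_weight n [::] = (n == 0)%:R.
Proof. by rewrite /count_weight big_nil mulr1 eq_sym. Qed.

(** Only one summand survives: if [x] lies in [A] it uses up one of the [n] hits, which is
    impossible for [n = 0]; otherwise all [n] hits fall in [s]. *)
Lemma count_weight_cons n x s : count_weight n (x :: s) =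
  (if n is n'.+1 then \1_A x * h x * count_weight n' s else 0) +
  (1 - \1_A x) * h x * count_weight n s.
Proof.
rewrite /count_weight big_cons /= indicE; case: (x \in A) => /=.
  by rewrite subrr !mul0r addr0 mul1r; case: n => [|n];
    rewrite ?mul0r// add1n eqSS mulrCA.
rewrite !(subr0, mul0r, mul1r, add0n) mulrCA.
by case: n => [|n]; rewrite ?mul0r add0r.
Qed.

Hypothesis h0 : forall x, 0 <= h x.

Lemma count_weight_ge0 n s : 0 <= count_weight n s.
Proof. by rewrite mulr_ge0// prodr_ge0. Qed.

Hypotheses (mA : measurable A) (mh : measurable_fun setT h).
Hypothesis mdiag : measurable [set p : T * T | p.1 = p.2].

Lemma measurable_fun_mem m :
  measurable_fun [set: T * m.-tuple T] (fun p => p.1 \in p.2).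
Proof.
apply: (measurable_fun_bool true); rewrite setTI.
rewrite (_ : _ @^-1` _ = \bigcup_(i in [set: 'I_m])
    ((fun p : T * m.-tuple T => (p.1, tnth p.2 i)) @^-1` [set p | p.1 = p.2])).
  apply: fin_bigcup_measurable => // i _; rewrite -[X in measurable X]setTI.
  have mf : measurable_fun setT
      (fun p : T * m.-tuple T => (p.1, tnth p.2 i)).
    apply: measurable_fun_pair => //.
    apply: (@measurableT_comp _ _ _ _ _ _ (@tnth m T ^~ i)) => //.
    exact: measurable_tnth.
  exact: mf.
apply/seteqP; split=> [p /= /tnthP[i pi]|p [i _] /= pi]; first by exists i.
by rewrite /= pi mem_tnth.
Qed.

(** [undup] drops [x] on the measurable event that [x] occurs in [t]; off it, [count_weight_cons]
    applies. Length [m] enters as a premise, so this serves both as the induction step for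
    measurability and for the integrand on pairs in Tonelli's theorem. *)
Let measurable_count_weight_undup_cons n m :
    (forall k, measurable_fun [set: m.-tuple T]
      (fun t => count_weight k (undup t))) ->
  measurable_fun [set: T * m.-tuple T]
    (fun p => count_weight n (undup (p.1 :: p.2))).
Proof.
move=> IH; pose f k (p : T * m.-tuple T) := count_weight k (undup p.2).
have mf k : measurable_fun setT (f k).
  exact: (measurableT_comp (IH k) measurable_snd).
rewrite (_ : (fun p => _) = (fun p => if p.1 \in p.2 then f n p else
    (if n is n'.+1 then \1_A p.1 * h p.1 * f n' p else 0) +
    (1 - \1_A p.1) * h p.1 * f n p)); last first.
  by apply/funext => p /=; case: ifP => // _; rewrite count_weight_cons.
have mh1 : measurable_fun setT (fun p : T * m.-tuple T => h p.1).
  exact: (measurableT_comp mh measurable_fst).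
have mA1 : measurable_fun setT (fun p : T * m.-tuple T => \1_A p.1 : R).
  apply: (@measurableT_comp _ _ _ _ _ _ (\1_A : T -> R)) => //.
apply: measurable_fun_ifT => //; first exact: measurable_fun_mem.
apply: measurable_funD.
  by case: n => // n; apply: measurable_funM => //; exact: measurable_funM.
apply: measurable_funM => //; apply: measurable_funM => //.
exact: measurable_funB.
Qed.

Lemma measurable_count_weight_undup n m :
  measurable_fun [set: m.-tuple T] (fun t => count_weight n (undup t)).
Proof.
elim: m n => [n|m IHm n].
  rewrite (_ : (fun _ => _) = cst (n == 0)%:R)//.
  by apply/funext => t; rewrite tuple0 /= count_weight_nil.
rewrite (_ : (fun _ => _) =
    (fun p : T * m.-tuple T => count_weight n (undup (p.1 :: p.2)))
      \o @uncons_pair _ T m); last first.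
  by apply/funext => t; rewrite {1}(tuple_eta t).
apply: measurableT_comp; first exact: measurable_count_weight_undup_cons.
exact: measurable_uncons_pair.
Qed.

Variable mu : {sigma_finite_measure set T -> \bar R}.
Hypothesis mu_set1 : forall x, mu [set x] = 0%E.

(** With [s] the entries of a fixed tail, these are the heads that [undup] would discard: a finite
    union of null points. *)
Lemma measure_mem_seq0 (s : seq T) :
  measurable [set x | x \in s] /\ mu [set x | x \in s] = 0%E.
Proof.
have m1 x : measurable [set x] := measurable_singleton x mdiag.
elim: s => [|y s [ms s0]].
  by rewrite set_nil; split; [exact: measurable0|exact: measure0].
rewrite (_ : [set` _] = [set y] `|` [set x | x \in s]); last first.
  apply/seteqP; split=> x /=; rewrite inE.
    by case/orP => [/eqP ->|xs]; [left|right].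
  by case=> [->|->]; rewrite ?eqxx ?orbT.
split; first exact: measurableU.
exact: (null_set_setU (m1 y) ms (mu_set1 y) s0).
Qed.

Variables a b : R.
Hypothesis intA : (\int[mu]_x (\1_A x * h x)%:E = a%:E)%E.
Hypothesis intAC : (\int[mu]_x ((1 - \1_A x) * h x)%:E = b%:E)%E.

Lemma integral_count_weight_undup n m :
  (\int[power_measure mu m]_t (count_weight n (undup t))%:E =
   ('C(m, n)%:R * a ^+ n * b ^+ (m - n))%:E)%E.
Proof.
have A01 x : 0 <= (\1_A x : R) <= 1.
  by rewrite indicE; case: (_ \in _); rewrite ?lexx ?ler01.
have h1_ge0 x : 0 <= \1_A x * h x.
  by rewrite mulr_ge0//; have /andP[] := A01 x.
have h2_ge0 x : 0 <= (1 - \1_A x) * h x.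
  by rewrite mulr_ge0// subr_ge0; have /andP[] := A01 x.
have mh1 : measurable_fun setT (fun x => (\1_A x * h x)%:E).
  by apply/measurable_EFinP; exact: measurable_funM.
have mh2 : measurable_fun setT (fun x => ((1 - \1_A x) * h x)%:E).
  by apply/measurable_EFinP; apply: measurable_funM => //;
    exact: measurable_funB.
elim: m n => [n|m IHm n].
  (* The 0-fold product is the unit mass at the empty tuple, and 'C(0, n) vanishes unless
     [n = 0]. *)
  rewrite /= integral_dirac//.
    rewrite diracT mul1e count_weight_nil; case: n => [|n].
      by rewrite bin0 !expr0 !mulr1.
    by rewrite bin0n /= !mul0r.
  by apply/measurable_EFinP; exact: measurable_count_weight_undup.
have mG k : measurable_fun [set: T * m.-tuple T]
    (fun p => (count_weight k (undup (p.1 :: p.2)))%:E).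
  apply/measurable_EFinP; apply: measurable_count_weight_undup_cons => j.
  exact: measurable_count_weight_undup.
have mF k : measurable_fun [set: m.-tuple T]
    (fun t => (count_weight k (undup t))%:E).
  by apply/measurable_EFinP; exact: measurable_count_weight_undup.
(* Pull back along [cons_pair], then apply Tonelli with the head integrated first and the tail held
   fixed. *)
rewrite [LHS](ge0_integral_pushforward (@measurable_cons_pair _ T m))//;
  last 2 first.
- by apply/measurable_EFinP; exact: measurable_count_weight_undup.
- by move=> t _; rewrite lee_fin count_weight_ge0.
rewrite preimage_setT [LHS](fubini_tonelli2 _ (mG n)); last first.
  by move=> p; rewrite lee_fin count_weight_ge0.
(* The weight of index n - 1, set to 0 at [n = 0], lets one recurrence cover both cases of [n]. *)
pose prv k s := if k is k'.+1 then count_weight k' s else 0.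
have prv_ge0 k s : 0 <= prv k s.
  by case: k => //= k; exact: count_weight_ge0.
have slice (t : m.-tuple T) :
    (\int[mu]_x (count_weight n (undup (x :: t)))%:E =
     a%:E * (prv n (undup t))%:E + b%:E * (count_weight n (undup t))%:E)%E.
  have [mt t0] := measure_mem_seq0 t.
  rewrite -intA -intAC muleC [X in (_ + X)%E]muleC.
  rewrite -!ge0_integralZl ?lee_fin ?count_weight_ge0//; last 2 first.
    by move=> x _; rewrite lee_fin.
    by move=> x _; rewrite lee_fin.
  rewrite -ge0_integralD//; last 4 first.
  - by move=> x _; rewrite -EFinM lee_fin mulr_ge0.
  - exact: measurable_funeM.
  - by move=> x _; rewrite -EFinM lee_fin mulr_ge0// count_weight_ge0.
  - exact: measurable_funeM.
  apply: ge0_ae_eq_integral => //.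
  - exact: (measurableT_comp (mG n) (measurable_pair2 t)).
  - by apply: emeasurable_funD; exact: measurable_funeM.
  - by move=> x _; rewrite lee_fin count_weight_ge0.
  - move=> x _; rewrite -!EFinM -EFinD lee_fin.
    by rewrite addr_ge0// mulr_ge0// count_weight_ge0.
  (* The exceptional null set consists of the entries of [t]; off it [undup (x :: t)] is
     [x :: undup t]. *)
  exists [set` (t : seq T)]; split => // x /=; apply: contra_notP => /negP xt _.
  rewrite /= (negbTE xt) count_weight_cons -!EFinM -EFinD; congr EFin.
  case: n => [|n]; rewrite /prv [X in _ = _ + X]mulrC ?mul0r//.
  by rewrite [X in _ = X + _]mulrC.
have mprv k : measurable_fun [set: m.-tuple T] (fun t => (prv k (undup t))%:E).
  case: k => [|k]; last exact: mF.
  by rewrite /prv; exact: measurable_cst.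
have Iprv : (\int[power_measure mu m]_t (prv n (undup t))%:E =
    (if n is n'.+1 then 'C(m, n')%:R * a ^+ n' * b ^+ (m - n') else 0)%:E)%E.
  by rewrite /prv; case: (n) => [|k]; [exact: integral0|exact: IHm].
have a0 : 0 <= a.
  by rewrite -lee_fin -intA; apply: integral_ge0 => x _; rewrite lee_fin.
have b0 : 0 <= b.
  by rewrite -lee_fin -intAC; apply: integral_ge0 => x _; rewrite lee_fin.
rewrite (eq_integral (fun t : m.-tuple T =>
  a%:E * (prv n (undup t))%:E + b%:E * (count_weight n (undup t))%:E)%E);
  last by move=> t _; exact: slice.
rewrite ge0_integralD//; last 4 first.
- by move=> t _; rewrite -EFinM lee_fin mulr_ge0.
- exact: measurable_funeM.
- by move=> t _; rewrite -EFinM lee_fin mulr_ge0// count_weight_ge0.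
- exact: measurable_funeM.
rewrite !ge0_integralZl//; last 2 first.
  by move=> x _; rewrite lee_fin count_weight_ge0.
  by move=> x _; rewrite lee_fin.
rewrite Iprv IHm -!EFinM -EFinD; congr EFin.
case: n {slice Iprv} => [|n].
  by rewrite !bin0 !subn0 mulr0 add0r !expr0 !mul1r -exprS.
rewrite binS natrD subSS !mulrDl.
(* For [m <= n] truncated subtraction breaks b * b^(m - n.+1) = b^(m - n), but the coefficient 'C(m,
   n.+1) of that term is then 0. *)
case: (ltnP n m) => nm; last first.
  by rewrite (@bin_small m n.+1)// mulr0n !mul0r mulr0 addr0 add0r exprS; ring.
by rewrite -(subnSK nm) !exprS; ring.
Qed.

End count_weight.

(** * Measurable diagonals, null points and compact sets in the state space *)

Lemma measurable_diag_real (R : realType) :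
  measurable [set p : measurableTypeR R * measurableTypeR R | p.1 = p.2].
Proof.
rewrite (_ : [set p | _] = (fun p : measurableTypeR R * measurableTypeR R =>
    (p.1 : R) == (p.2 : R)) @^-1` [set true]); last first.
  by apply/seteqP; split=> p /= /eqP.
rewrite -[X in measurable X]setTI.
exact: (measurable_fun_eqr (D := setT) (R := R) measurable_fst measurable_snd).
Qed.

Lemma measurable_diag_tuple d (T : measurableType d) (n : nat) :
  measurable [set p : T * T | p.1 = p.2] ->
  measurable [set p : n.-tuple T * n.-tuple T | p.1 = p.2].
Proof.
move=> mdiag; rewrite (_ : [set p | _] = \bigcap_(i in [set: 'I_n])
    ((fun p : n.-tuple T * n.-tuple T => (tnth p.1 i, tnth p.2 i))
      @^-1` [set p | p.1 = p.2])).
  apply: fin_bigcap_measurable => // i _; rewrite -[X in measurable X]setTI.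
  have mf : measurable_fun setT
      (fun p : n.-tuple T * n.-tuple T => (tnth p.1 i, tnth p.2 i)).
    by apply: measurable_fun_pair;
      apply: (@measurableT_comp _ _ _ _ _ _ (@tnth n T ^~ i)) => //;
      exact: measurable_tnth.
  exact: mf.
apply/seteqP; split=> [p /= pE i _ /=|p pE]; first by rewrite pE.
by apply: eq_from_tnth => i; exact: (pE i).
Qed.

Lemma measurable_diag_prod d1 d2 (T1 : measurableType d1)
    (T2 : measurableType d2) :
  measurable [set p : T1 * T1 | p.1 = p.2] ->
  measurable [set p : T2 * T2 | p.1 = p.2] ->
  measurable [set p : (T1 * T2) * (T1 * T2) | p.1 = p.2].
Proof.
move=> m1 m2; rewrite (_ : [set p | _] =
    (fun p : (T1 * T2) * (T1 * T2) => (p.1.1, p.2.1)) @^-1` [set p | p.1 = p.2]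
    `&` (fun p : (T1 * T2) * (T1 * T2) => (p.1.2, p.2.2)) @^-1`
      [set p | p.1 = p.2]).
  have mf1 : measurable_fun setT
      (fun p : (T1 * T2) * (T1 * T2) => (p.1.1, p.2.1)).
    by apply: measurable_fun_pair; apply: measurableT_comp.
  have mf2 : measurable_fun setT
      (fun p : (T1 * T2) * (T1 * T2) => (p.1.2, p.2.2)).
    by apply: measurable_fun_pair; apply: measurableT_comp.
  by apply: measurableI; rewrite -[X in measurable X]setTI;
    [exact: mf1|exact: mf2].
apply/seteqP; split=> [p /= ->//|[[x1 x2] [y1 y2]] [/= -> ->]//].
Qed.

Lemma measurable_diag_state (R : realType) (ns nv : nat) :
  measurable [set p : state R ns nv * state R ns nv | p.1 = p.2].
Proof.
by apply: measurable_diag_prod; apply: measurable_diag_tuple;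
  exact: measurable_diag_real.
Qed.

(** A point is the product of its head and its tail, and the head is Lebesgue-null. Dimension 0 is
    excluded: there the measure is a unit mass. *)
Lemma lebesgue_euclidean_set1 (R : realType) (n : nat) (x : euclidean R n.+1) :
  lebesgue_euclidean R n.+1 [set x] = 0%E.
Proof.
rewrite /lebesgue_euclidean /=.
rewrite /cons_measure /pushforward (_ : _ @^-1` _ =
    [set thead x] `*` [set [tuple of behead x]]).
  rewrite [LHS]product_measure1E; last 2 first.
  - exact: (measurable_singleton _ (@measurable_diag_real R)).
  - apply: measurable_singleton.
    exact: (measurable_diag_tuple (@measurable_diag_real R)).
  have := lebesgue_measure.lebesgue_measure_set1 (thead x : R).
  by rewrite /= => ->; rewrite mul0e.
apply/seteqP; split=> [[a t] /= <-|[a t] [/= -> ->]].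
  by split; rewrite ?theadE//; exact: val_inj.
by rewrite [RHS]tuple_eta; exact: val_inj.
Qed.

(** At least one of the two factors has positive dimension, and its zero annihilates the other,
    which may be a unit mass. *)
Lemma state_measure_set1 (R : realType) (ns nv : nat) (x : state R ns nv) :
  (0 < ns + nv)%N -> state_measure R ns nv [set x] = 0%E.
Proof.
move=> n0; rewrite (_ : [set x] = [set x.1] `*` [set x.2]); last first.
  by case: x => x1 x2; apply/seteqP; split=> [_ ->//|[y1 y2] [/= -> ->]].
have mdiag n : measurable [set p : euclidean R n * euclidean R n | p.1 = p.2].
  exact: (measurable_diag_tuple (@measurable_diag_real R)).
rewrite [LHS]product_measure1E; [|exact: (measurable_singleton _ (mdiag _))..].
move: x; case: ns n0 => [|ns] n0 x; last first.
  by rewrite [X in (X * _)%E]lebesgue_euclidean_set1 mul0e.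
case: nv n0 x => // nv _ x.
by rewrite [X in (_ * X)%E]lebesgue_euclidean_set1 mule0.
Qed.

(* S is the intersection over k of finite unions of balls of radius 1/(k+1)
   centred in S, and such balls are boxes for the sup norm. *)
Lemma euclidean_compact_measurable (R : realType) (n : nat)
    (S : set (euclidean R n)) : euclidean_compact S -> measurable S.
Proof.
pose row (t : euclidean R n) : 'rV[R]_n := \row_i (tnth t i : R).
have row_inj : injective row.
  move=> t u tu; apply: eq_from_tnth => i.
  by have := congr1 (fun M : 'rV[R]_n => M ord0 i) tu; rewrite !mxE.
move=> cS; have clS : closed (row @` S).
  by apply: compact_closed => //; exact: norm_hausdorff.
have mball (c : 'rV[R]_n) (e : R) : 0 < e -> measurable (row @^-1` ball c e).
  move=> e0; rewrite (_ : _ @^-1` _ = \bigcap_(i in [set: 'I_n])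
      ((@tnth n _ ^~ i) @^-1` (ball (c ord0 i) e : set R))).
    apply: fin_bigcap_measurable => // i _; rewrite -[X in measurable X]setTI.
    apply: measurable_tnth => //; apply: open_measurable; exact: ball_open.
  apply/seteqP; split=> [t [_ tc] i _ /=|t tc].
    by have := tc ord0 i; rewrite mxE.
  split=> // i j; rewrite (ord1 i) mxE; exact: (tc j).
have cover e : 0 < e -> exists2 U : set 'rV[R]_n,
    row @` S `<=` U /\ measurable (row @^-1` U) &
    U `<=` [set v | exists2 w, (row @` S) w & ball w e v].
  move=> e0; move: cS; rewrite /euclidean_compact compact_cover => cS.
  have [||D DS SD] := cS _ (row @` S) (fun w => ball w e).
  - by move=> w _; exact: ball_open.
  - by move=> w Sw; exists w => //; exact: ballxx.
  exists (\bigcup_(w in [set` D]) ball w e); last first.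
    move=> v [w Dw wv]; exists w => //; have := DS w Dw; by rewrite inE.
  split=> //; rewrite preimage_bigcup; apply: fin_bigcup_measurable => //.
  by move=> w _; exact: mball.
pose e k : R := k.+1%:R^-1.
have e0 k : 0 < e k by rewrite /e invr_gt0.
have /choice[U HU] : forall k, exists U : set 'rV[R]_n,
    [/\ row @` S `<=` U, measurable (row @^-1` U) &
    U `<=` [set v | exists2 w, (row @` S) w & ball w (e k) v]].
  by move=> k; have [V [? ?] ?] := cover _ (e0 k); exists V.
rewrite (_ : S = \bigcap_k (row @^-1` U k)).
  by apply: bigcapT_measurable => k; have [] := HU k.
apply/seteqP; split=> [t St k _|t Ut].
  by have [+ _ _] := HU k; apply; exists t.
(* A point of every [U k] is within 1/(k+1) of the image of [S], hence in its closure, which is the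
   image itself; injectivity of [row] returns to [S]. *)
suff [u Su /row_inj <-//] : (row @` S) (row t).
apply: clS => B /nbhs_ballP[r /= r0 rB].
have [k kr] : exists k, e k < r.
  have [k _ /(_ k (leqnn k)) ?] := near_infty_natSinv_lt (PosNum r0).
  by exists k.
have [_ _ /(_ _ (Ut k I))[w Sw wt]] := HU k.
exists w; split => //; apply: rB; apply: ball_sym.
by apply: le_ball wt; exact: ltW.
Qed.

(** * The integrand of the set integral as a count weight *)

Lemma prodr_natb (R : comNzRingType) (I : Type) (s : seq I) (p : pred I) :
  \prod_(x <- s) ((p x)%:R : R) = (all p s)%:R.
Proof.
by elim: s => [|x s IH]; rewrite ?big_nil// big_cons IH -natrM mulnb.
Qed.

(** Only the subset [Z0] of all points of [Y] satisfying [p] contributes: a point of [Z] failing [p]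
    kills the first product, a point of [Y] outside [Z] satisfying [p] kills the second. *)
Lemma sum_fpowerset_indic (R : comNzRingType) (K : choiceType) (p : pred K)
    (n : nat) (Y : {fset K}) :
  \sum_(Z <- fpowerset Y | #|` Z| == n)
     (\prod_(x <- Z) ((p x)%:R : R)) *
     (\prod_(x <- (Y `\` Z)%fset) (1 - (p x)%:R)) = (count p Y == n)%:R.
Proof.
pose Z0 := [fset x in Y | p x]%fset.
have Z0E : #|` Z0| = count p Y.
  rewrite -size_filter; apply/perm_size/uniq_perm => //.
    by rewrite filter_uniq.
  by move=> x; rewrite mem_filter !inE andbC.
have termE (Z : {fset K}) : Z \in fpowerset Y ->
    (\prod_(x <- Z) ((p x)%:R : R)) *
     (\prod_(x <- (Y `\` Z)%fset) (1 - (p x)%:R)) = (Z == Z0)%:R.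
  rewrite fpowersetE => /fsubsetP ZY.
  rewrite [X in _ * X](eq_bigr (fun x => (~~ p x)%:R)); last first.
    by move=> x _; case: (p x); rewrite ?subrr ?subr0.
  rewrite !prodr_natb -natrM mulnb; congr (nat_of_bool _)%:R.
  apply/andP/eqP => [[/allP pZ /allP pYZ]|->].
    apply/fsetP => x; rewrite !inE; apply/idP/andP => [xZ|[xY px]].
      by split; [exact: ZY|exact: pZ].
    apply/negPn/negP => xZ; have := pYZ x; rewrite !inE xZ xY px.
    by move=> /(_ isT).
  split; apply/allP => x; rewrite !inE; first by case/andP.
  by case/andP => /[swap] ->; rewrite andTb.
rewrite big_seq_cond.
rewrite (eq_bigr (fun Z => (Z == Z0)%:R)); last by move=> Z /andP[/termE].
have Z0Y : Z0 \in fpowerset Y.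
  by rewrite fpowersetE; apply/fsubsetP => x; rewrite !inE => /andP[].
rewrite -big_seq_cond big_mkcond (bigD1_seq Z0) ?fset_uniq//=.
rewrite Z0E eqxx big1 ?addr0 => [|Z /negbTE ->]; last by rewrite if_same.
by case: ifP.
Qed.

(** The set of entries of [t] forgets repetitions; with [undup t] the identity holds for every
    tuple, not just almost every one. *)
Lemma poisson_integrandE (R : realType) (ns nv : nat) (X : set (state R ns nv))
    (D : state R ns nv -> R) (S : set (euclidean R ns)) (n m : nat)
    (t : m.-tuple (state R ns nv)) :
  let Y := [fset x in (t : seq _)]%fset in
  fov_card_cond S n Y * poisson_density X D Y =
  expR (- card_mean X D) * count_weight (fst @^-1` S) D n (undup t).
Proof.
move=> Y; have YE : perm_eq Y (undup t).
  apply: uniq_perm => [||x]; rewrite ?fset_uniq ?undup_uniq//.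
  by rewrite mem_undup !inE.
rewrite -(perm_count_weight _ _ _ YE) /poisson_density /fov_card_cond.
by rewrite (sum_fpowerset_indic R (fun x => x.1 \in S)) mulrCA.
Qed.

(** * The Poisson series and its total mass *)

Section poisson_series.
Variables (R : realType) (a b : R).
Hypotheses (a0 : 0 <= a) (b0 : 0 <= b).

(** The m-th term of the set integral, with a + b for the global mean. The binomial form makes it
    vanish for [m < n], so that both indices can range over all naturals when sums are exchanged. *)
Definition poisson_term (n m : nat) : R :=
  m`!%:R^-1 * (expR (- (a + b)) * ('C(m, n)%:R * a ^+ n * b ^+ (m - n))).

Lemma poisson_term_ge0 n m : 0 <= poisson_term n m.
Proof. by rewrite /poisson_term !mulr_ge0 ?invr_ge0 ?expR_ge0 ?exprn_ge0. Qed.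

Lemma poisson_term_small n m : (m < n)%N -> poisson_term n m = 0.
Proof. by move=> mn; rewrite /poisson_term bin_small// !mul0r !mulr0. Qed.

Lemma poisson_termE n m : (n <= m)%N -> poisson_term n m =
  expR (- (a + b)) / (n`!%:R * (m - n)`!%:R) * a ^+ n * b ^+ (m - n).
Proof.
move=> nm; rewrite /poisson_term -(bin_fact nm) !natrM.
have f0 k : (k`!%:R : R) != 0 by rewrite pnatr_eq0 -lt0n fact_gt0.
have c0 : ('C(m, n)%:R : R) != 0 by rewrite pnatr_eq0 -lt0n bin_gt0.
have := f0 n; have := f0 (m - n)%N; move: c0.
move: ('C(m, n)%:R) (n`!%:R) ((m - n)`!%:R) (expR _) => c x y e c0 x0 y0.
by field; rewrite c0 x0 y0.
Qed.

Lemma poisson_seriesE n : (\sum_(m <oo) (poisson_term n m)%:E =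
  \sum_(n <= m <oo) (expR (- (a + b)) / (n`!%:R * (m - n)`!%:R)
    * a ^+ n * b ^+ (m - n))%:E)%E.
Proof.
rewrite [RHS]eseries_cond [RHS]eseries_mkcond; apply: eq_eseriesr => m _ /=.
by case: leqP => nm; [rewrite poisson_termE|rewrite poisson_term_small].
Qed.

(** Terms with [n > m] vanish, and the remaining finite sum is the binomial expansion of (a + b)^m /
    m!. *)
Lemma sum_poisson_term m : (\sum_(n <oo) (poisson_term n m)%:E =
  (expR (- (a + b)))%:E * (exp_coeff (a + b) m)%:E)%E.
Proof.
rewrite (nneseries_split 0 m.+1); last first.
  by move=> k _; rewrite lee_fin poisson_term_ge0.
rewrite [X in (_ + X)%E]eseries0 ?adde0; last first.
  by move=> k /= mk _; rewrite poisson_term_small.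
rewrite add0n sumEFin -EFinM; congr EFin; rewrite big_mkord.
have -> : exp_coeff (a + b) m =
    (\sum_(i < m.+1) 'C(m, i)%:R * a ^+ i * b ^+ (m - i)) / m`!%:R.
  rewrite /exp_coeff /= addrC exprDn; congr (_ / _).
  by apply: eq_bigr => i _; rewrite -mulr_natl mulrCA -mulrA mulrC -mulrA.
rewrite mulr_suml mulr_sumr; apply: eq_bigr => i _.
by rewrite /poisson_term [RHS]mulrA [RHS]mulrC.
Qed.

(** Nonnegativity allows summing over [n] first; what is left is exp(-(a + b)) times the exponential
    series at a + b. *)
Lemma poisson_series_mass :
  (\sum_(n <oo) \sum_(m <oo) (poisson_term n m)%:E = 1)%E.
Proof.
rewrite nneseries_interchange; last first.
  by move=> *; rewrite lee_fin poisson_term_ge0.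
rewrite (eq_eseriesr (fun m _ => sum_poisson_term m)).
rewrite nneseriesZl; last first.
  by move=> m _; rewrite lee_fin /exp_coeff/= divr_ge0// exprn_ge0// addr_ge0.
rewrite -[RHS](_ : (expR (- (a + b)))%:E * (expR (a + b))%:E = 1)%E; last first.
  by rewrite -EFinM expRN mulVf ?gt_eqF ?expR_gt0.
congr (_ * _)%E; rewrite /expR -EFin_lim; last first.
  exact: is_cvg_series_exp_coeff.
by apply/congr_lim/funext => k /=; rewrite sumEFin.
Qed.

End poisson_series.

(** * From the set integral over X to the Poisson series *)

Lemma integral_cartesian_power (R : realType) (ns nv : nat)
    (X : set (state R ns nv)) (D : state R ns nv -> R)
    (S : set (euclidean R ns)) (n m : nat) :
  (\int[power_measure (state_measure R ns nv) m]_
      (t in cartesian_power X (m := m))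
    (fov_card_cond S n [fset x in (t : seq (state R ns nv))]%fset *
     poisson_density X D [fset x in (t : seq (state R ns nv))]%fset)%:E =
  \int[power_measure (state_measure R ns nv) m]_t
    ((expR (- card_mean X D))%:E *
     (count_weight (fst @^-1` S) (D \_ X) n (undup t))%:E))%E.
Proof.
rewrite integral_mkcond; apply: eq_integral => t _.
rewrite patchE -EFinM poisson_integrandE; case: ifPn => [|] Xt.
  congr (_ * _)%:E; congr (_ * _); apply: eq_big_seq => x.
  rewrite mem_undup => /tnthP[i ->]; rewrite patchE mem_set//.
  by move: Xt; rewrite inE; apply.
(* A tuple leaving X^m has an entry at which the zero extension of [D] vanishes, so its weight is 0,
   as is the restricted integrand. *)
have [i Xi] : exists i, ~ X (tnth t i).
  by apply/existsNP; move: Xt; rewrite notin_setE.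
rewrite /count_weight; have -> : \prod_(x <- undup t) (D \_ X) x = 0.
  apply/eqP; rewrite prodf_seq_eq0; apply/hasP; exists (tnth t i).
    by rewrite mem_undup mem_tnth.
  by rewrite patchE memNset//= eqxx.
by rewrite !mulr0.
Qed.

Theorem proposition1 (R : realType) (ns nv : nat)
  (Xs : set (euclidean R ns)) (Xv : set (euclidean R nv))
  (D : state R ns nv -> R) (S : set (euclidean R ns)) :
  (0 < ns + nv)%N ->
  measurable Xs -> measurable Xv ->
  let X : set (state R ns nv) := Xs `*` Xv in
  measurable_fun X D ->
  (forall x, X x -> 0 <= D x) ->
  (\int[state_measure R ns nv]_(x in X) (D x)%:E < +oo)%E ->
  S `<=` Xs -> euclidean_compact S ->
  let rho := fov_card_dist X S (poisson_density X D) in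
  is_pmf rho /\
  forall n : nat,
    rho n =
    (\sum_(n <= m <oo)
       (expR (- card_mean X D) / (n`!%:R * (m - n)`!%:R)
        * inner X (fov_indic S) D ^+ n
        * inner X (fun x => 1 - fov_indic S x) D ^+ (m - n))%:E)%E.
Proof.
move=> n_gt0 mXs mXv X mD D0 Doo _ cS rho.
have mX : measurable X by exact: measurableX.
pose A : set (state R ns nv) := fst @^-1` S.
have mA : measurable A.
  rewrite -[X in measurable X]setTI.
  by apply: measurable_fst => //; exact: euclidean_compact_measurable.
pose h := D \_ X.
have h0 x : 0 <= h x.
  by rewrite /h patchE; case: ifPn => // /set_mem; exact: D0.
have mh : measurable_fun setT h.
  by apply/(measurable_restrictT _ mX).
have int_h : (\int[state_measure R ns nv]_x (h x)%:E =
    \int[state_measure R ns nv]_(x in X) (D x)%:E)%E.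
  by rewrite [RHS]integral_mkcond; apply: eq_integral => x _;
    rewrite /h !patchE; case: ifP.
(* [inner] is the finite part of an extended integral; domination by the integral of [D] shows that
   nothing is lost. *)
have innerE (c : state R ns nv -> R) : measurable_fun setT c ->
    (forall x, 0 <= c x <= 1) ->
    (\int[state_measure R ns nv]_x (c x * h x)%:E = (inner X c D)%:E)%E.
  move=> mc c01; have ch0 x : 0 <= c x * h x.
    by rewrite mulr_ge0//; have /andP[] := c01 x.
  have mch : measurable_fun setT (fun x => (c x * h x)%:E).
    by apply/measurable_EFinP; exact: measurable_funM.
  rewrite /inner /Rintegral (_ : (\int[_]_(x in X) _)%E =
    (\int[state_measure R ns nv]_x (c x * h x)%:E)%E); last first.
    rewrite integral_mkcond; apply: eq_integral => x _.
    by rewrite /h !patchE; case: ifP => // _; rewrite mulr0.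
  rewrite fineK// ge0_fin_numE; last first.
    by apply: integral_ge0 => x _; rewrite lee_fin.
  apply: le_lt_trans Doo; rewrite -int_h; apply: ge0_le_integral => //.
  - by move=> x _; rewrite lee_fin.
  - exact/measurable_EFinP.
  - move=> x _; rewrite lee_fin ler_piMl//; by have /andP[] := c01 x.
have mindic : measurable_fun setT (\1_A : _ -> R) by exact: measurable_indic.
have indic01 x : 0 <= (\1_A x : R) <= 1.
  by rewrite indicE; case: (_ \in _); rewrite ?lexx ?ler01.
pose a := inner X (fov_indic S) D.
pose b := inner X (fun x => 1 - fov_indic S x) D.
have intA : (\int[state_measure R ns nv]_x (\1_A x * h x)%:E = a%:E)%E.
  exact: innerE.
have intAC : (\int[state_measure R ns nv]_x ((1 - \1_A x) * h x)%:E = b%:E)%E.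
  apply: innerE; first exact: measurable_funB.
  move=> x; have /andP[? ?] := indic01 x.
  by rewrite subr_ge0 lerBlDr lerDl; apply/andP.
have a0 : 0 <= a.
  by rewrite -lee_fin -intA; apply: integral_ge0 => x _;
    rewrite lee_fin mulr_ge0//; have /andP[] := indic01 x.
have b0 : 0 <= b.
  by rewrite -lee_fin -intAC; apply: integral_ge0 => x _;
    rewrite lee_fin mulr_ge0// subr_ge0; have /andP[] := indic01 x.
(* The indicators of [A] and of its complement sum to 1. *)
have abE : card_mean X D = a + b.
  rewrite /card_mean /Rintegral -int_h -[RHS]/(fine (a%:E + b%:E)%E).
  rewrite -intA -intAC.
  congr fine; rewrite -ge0_integralD//.
  - by apply: eq_integral => x _; rewrite -EFinD -mulrDl addrC subrK mul1r.
  - move=> x _; rewrite lee_fin mulr_ge0//; by have /andP[] := indic01 x.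
  - by apply/measurable_EFinP; exact: measurable_funM.
  - by move=> x _; rewrite lee_fin mulr_ge0// subr_ge0.
  - apply/measurable_EFinP; apply: measurable_funM => //.
    exact: measurable_funB.
(* Termwise in [m]: the constant exp(-N) leaves the integral, and the binomial formula evaluates the
   rest. *)
have rhoE n : rho n = (\sum_(m <oo) (poisson_term a b n m)%:E)%E.
  apply: eq_eseriesr => m _; rewrite integral_cartesian_power abE.
  rewrite ge0_integralZl//; last 2 first.
  - apply/measurable_EFinP; apply: measurable_count_weight_undup => //.
    exact: measurable_diag_state.
  - by move=> t _; rewrite lee_fin count_weight_ge0.
  rewrite (integral_count_weight_undup h0 mA mh _ _ intA intAC)//.
  - exact: measurable_diag_state.
  - by move=> x; exact: state_measure_set1.
split; last by move=> n; rewrite rhoE poisson_seriesE// abE.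
split=> [n|].
  by rewrite rhoE nneseries_ge0// => m _ _; rewrite lee_fin poisson_term_ge0.
by under eq_eseriesr do rewrite rhoE; exact: poisson_series_mass.
Qed.
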